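(* Let $G=(V,E)$ be a locally finite (unweighted) graph such that $\kappa(x,y)>0$ for all neighboring vertices $x\sim y$. Then for every function $f:V\to\mathbb{R}$ and every $x\in V$, $$\Gamma_2(f,f)(x)\geq\frac{1}{2}(\Delta f(x))^2+\left(\frac{5}{2D(x)}-1\right)\Gamma(f,f)(x).$$
   Context: Graphs $G=(V,E)$ are undirected, connected, simple, without loops; $V$ may be infinite; locally finite means every vertex has finitely many neighbors. $x\sim y$ means $x,y$ are neighbors, and $d_x$ is the degree (number of neighbors) of $x$. $d$ is the graph distance (number of edges of a shortest path). For each vertex $x$, $m_x$ is the probability measure on $V$ with $m_x(y)=1/d_x$ if $y\sim x$ and $m_x(y)=0$ otherwise. $W_1(\mu_1,\mu_2)=\inf_\xi\sum_{x',y'}d(x',y')\xi(x',y')$, the infimum over all probability measures $\xi$ on $V\times V$ with marginals $\mu_1$ and $\mu_2$. The Ollivier-Ricci curvature is $\kappa(x,y)=1-\frac{W_1(m_x,m_y)}{d(x,y)}$ for $x\neq y$. The Laplace operator is $\Delta f(x)=\frac{1}{d_x}\sum_{y:\,y\sim x}(f(y)-f(x))$. Further, $\Gamma(f,g)=\frac12\{\Delta(fg)-f\Delta g-g\Delta f\}$ and $\Gamma_2(f,g)=\frac12\{\Delta\Gamma(f,g)-\Gamma(f,\Delta g)-\Gamma(\Delta f,g)\}$. $D(x)=\max_{y:\,y\sim x}d_y$. *)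

(* Defs.v *)
From HB Require Import structures.
From mathcomp Require Import all_boot all_order all_algebra.
From mathcomp Require Import finmap.
From mathcomp Require Import all_classical all_reals all_analysis.

Set Implicit Arguments.
Unset Strict Implicit.
Unset Printing Implicit Defensive.

Import Order.TTheory GRing.Theory Num.Theory.
Local Open Scope classical_set_scope.
Local Open Scope ring_scope.

Record lfgraph (V : choiceType) := LFGraph {
  adj :> rel V;
  adj_sym : symmetric adj;
  adj_irr : irreflexive adj;
  adj_conn : forall x y, exists p : seq V, path adj x p /\ last x p = y;
  adj_lf : forall x, finite_set [set y | adj x y]
}.

Section Graph.
Variables (V : choiceType) (G : lfgraph V).

Definition nbr (x : V) : {fset V} := fset_set [set y | G x y].

Definition deg (x : V) : nat := #|` nbr x|.

Definition maxdeg_nbr (x : V) : nat := \max_(y <- nbr x) deg y.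

(* [path] allows repeated vertices; this does not change the minimal length. *)
Definition joined_in (x y : V) (n : nat) : Prop :=
  exists p : seq V, [/\ path G x p, last x p = y & size p = n].

Lemma joined_in_ex (x y : V) : exists n, `[< joined_in x y n >].
Proof.
have [p [xp py]] := adj_conn G x y.
by exists (size p); apply/asboolP; exists p.
Qed.

Definition dist (x y : V) : nat := ex_minn (joined_in_ex x y).

End Graph.

Section Transport.
Variable R : realType.

(* A probability measure on a discrete (possibly infinite) space is given by
   its mass function; [esum] is the unordered sum of nonnegative terms. *)
Definition is_prob (T : choiceType) (p : T -> R) : Prop :=
  (forall t, 0 <= p t) /\ \esum_(t in [set: T]) (p t)%:E = 1%E.

Definition is_coupling (V : choiceType) (mu nu : V -> R) (xi : V * V -> R)
    : Prop :=
  [/\ is_prob xi,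
      forall x, \esum_(y in [set: V]) (xi (x, y))%:E = (mu x)%:E &
      forall y, \esum_(x in [set: V]) (xi (x, y))%:E = (nu y)%:E].

Variables (V : choiceType) (G : lfgraph V).

Definition W1 (mu nu : V -> R) : \bar R :=
  ereal_inf [set \esum_(p in [set: V * V])
                   ((dist G p.1 p.2)%:R * xi p)%:E
            | xi in [set xi | is_coupling mu nu xi]].

Definition walk_measure (x y : V) : R :=
  if G x y then (deg G x)%:R^-1 else 0.

(* Extended-real valued, so that no default value is used if W1 is infinite;
   only meaningful for x != y. *)
Definition kappa (x y : V) : \bar R :=
  (1 - W1 (walk_measure x) (walk_measure y) * ((dist G x y)%:R^-1)%:E)%E.

End Transport.

Section Calculus.
Variables (R : realType) (V : choiceType) (G : lfgraph V).
Implicit Types f g : V -> R.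

Definition Delta f (x : V) : R :=
  (deg G x)%:R^-1 * \sum_(y <- nbr G x) (f y - f x).

Definition Gamma f g (x : V) : R :=
  2^-1 * (Delta (fun z => f z * g z) x - f x * Delta g x - g x * Delta f x).

Definition Gamma2 f g (x : V) : R :=
  2^-1 * (Delta (Gamma f g) x - Gamma f (Delta g) x - Gamma (Delta f) g x).

End Calculus.

(* Main.v *)
Require Import Defs.
From HB Require Import structures.
From mathcomp Require Import all_boot all_order all_algebra.
From mathcomp Require Import finmap.
From mathcomp Require Import all_classical all_reals all_analysis.
From mathcomp Require Import ring lra.

(** Write a_y = f y - f x for the neighbours y of x, and D for the largest degree
    of a neighbour of x. Expanding the definitions gives the Bochner-type
    identity [Gamma2E]
      Gamma2 f f x = 1/2 (Delta f x)^2 - Gamma f f x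
        + 1/(4 d_x) sum_(y ~ x) 1/d_y sum_(z ~ y) (f x - 2 f y + f z)^2,
    so that everything rests on bounding the second differences
    f x - 2 f y + f z along the two-step paths x, y, z from below by
      (5 / D) sum_(y ~ x) a_y^2.

    As d_y <= D and all terms are squares, it is enough to look at two kinds of
    paths. The path which returns to z = x contributes 4 a_y^2. A path inside a
    triangle x, y, z contributes (a_z - 2 a_y)^2, which alone can vanish, but
    the same triangle also gives the path x, z, y, and
      (a_z - 2 a_y)^2 + (a_y - 2 a_z)^2
        = a_y^2 + a_z^2 + 4 (a_y - a_z)^2 >= a_y^2 + a_z^2.
    Hence the triangles contribute at least one more sum of the a_y^2
    ([sum_sqr_le_triangles]), provided that every edge x y lies in a triangle.

    This is where curvature enters ([kappa_gt0_triangle]). If x and y have no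
    common neighbour, the walk measures at x and y have disjoint supports, so
    every unit of mass has to travel a distance at least 1; then W1 >= 1 and
    kappa x y <= 0. *)

Set Implicit Arguments.
Unset Strict Implicit.
Unset Printing Implicit Defensive.

Import Order.TTheory GRing.Theory Num.Theory.
Local Open Scope ring_scope.

Section Neighbours.
Variables (V : choiceType) (G : lfgraph V).

Lemma in_nbr (x y : V) : (y \in nbr G x) = G x y.
Proof.
rewrite /nbr in_fset_set; last exact: adj_lf.
by apply/idP/idP => [/set_mem|h]; last apply/mem_set.
Qed.

Lemma deg_gt0 (x y : V) : G x y -> (0 < deg G x)%N.
Proof. by rewrite -in_nbr /deg cardfs_gt0 => xy; apply/fset0Pn; exists y. Qed.

Lemma deg_le_maxdeg_nbr (x y : V) : G x y -> (deg G y <= maxdeg_nbr G x)%N.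
Proof. by move=> xy; apply: leq_bigmax_seq => //; rewrite in_nbr. Qed.

Lemma dist_gt0 (x y : V) : x != y -> (0 < dist G x y)%N.
Proof.
rewrite /dist; case: ex_minnP => -[|//] /asboolP[p [_ py /size0nil p0]] _.
by move: py; rewrite p0 /= => ->; rewrite eqxx.
Qed.

Lemma dist_adj (x y : V) : G x y -> dist G x y = 1%N.
Proof.
move=> xy; apply/eqP; rewrite eqn_leq dist_gt0 ?andbT.
  rewrite /dist; case: ex_minnP => n _; apply.
  by apply/asboolP; exists [:: y]; rewrite /= xy.
by apply: contraTneq xy => ->; rewrite adj_irr.
Qed.

End Neighbours.

Section Triangle.
Variables (R : realType) (V : choiceType) (G : lfgraph V).

Lemma esum_ge_term (T : choiceType) (a : T -> \bar R) (t : T) :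
  (forall u, 0 <= a u)%E -> (a t <= \esum_(u in [set: T]) a u)%E.
Proof.
move=> a0; apply: esum_ge; exists [set t]%classic; last by rewrite fsbig_set1.
by split => //; exact: finite_set1.
Qed.

Lemma coupling_le_l (mu nu : V -> R) (xi : V * V -> R) (x y : V) :
  is_coupling mu nu xi -> xi (x, y) <= mu x.
Proof.
move=> [[xi0 _] hmu _]; rewrite -lee_fin -hmu.
by apply: (esum_ge_term (a := fun y => (xi (x, y))%:E)) => u; rewrite lee_fin.
Qed.

Lemma coupling_le_r (mu nu : V -> R) (xi : V * V -> R) (x y : V) :
  is_coupling mu nu xi -> xi (x, y) <= nu y.
Proof.
move=> [[xi0 _] _ hnu]; rewrite -lee_fin -hnu.
by apply: (esum_ge_term (a := fun x => (xi (x, y))%:E)) => u; rewrite lee_fin.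
Qed.

(** Each entry of a coupling is bounded by both marginals, so here the coupling
    vanishes on the diagonal; off the diagonal the distance is at least 1, and
    the cost is at least the total mass. *)
Lemma disjoint_W1_ge1 (mu nu : V -> R) :
  (forall z, mu z = 0 \/ nu z = 0) -> (1 <= W1 G mu nu)%E.
Proof.
move=> disj; apply: le_ereal_inf_tmp => _ [xi cxi <-].
have [[xi0 <-] _ _] := cxi.
apply: le_esum => -[u v] _ /=; rewrite lee_fin.
have [uv|/(dist_gt0 G) uv] := eqVneq u v.
  suff -> : xi (u, v) = 0 by rewrite mulr0.
  apply/eqP; rewrite eq_le xi0 andbT.
  have [<-|<-] := disj v.
    by rewrite -{2}uv; exact: coupling_le_l cxi.
  exact: coupling_le_r cxi.
by rewrite ler_peMl // ler1n.
Qed.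

(** Without a common neighbour the two walk measures have disjoint supports. *)
Lemma kappa_gt0_triangle (x y : V) :
  G x y -> (0 < kappa R G x y)%E -> exists2 z, G x z & G y z.
Proof.
move=> xy; apply: contraPP => no_triangle.
apply/negP; rewrite -leNgt /kappa dist_adj // invr1 mule1.
rewrite sube_le0; apply: disjoint_W1_ge1 => z.
rewrite /walk_measure; case: ifP => [xz|]; last by left.
by case: ifP => [yz|]; [case: no_triangle; exists z | right].
Qed.

End Triangle.

Section BakryEmery.
Variables (R : realType) (V : choiceType) (G : lfgraph V).
Implicit Types f g : V -> R.

(** Gamma is a mean of products of increments; in this form it is visibly
    bilinear, symmetric and nonnegative on the diagonal. *)
Lemma GammaE f g (x : V) :
  Gamma G f g x =
  2^-1 * ((deg G x)%:R^-1 * \sum_(y <- nbr G x) (f y - f x) * (g y - g x)).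
Proof.
rewrite /Gamma /Delta.
have -> : \sum_(y <- nbr G x) (f y - f x) * (g y - g x) =
    \sum_(y <- nbr G x) (f y * g y - f x * g x)
    - f x * \sum_(y <- nbr G x) (g y - g x)
    - g x * \sum_(y <- nbr G x) (f y - f x).
  by rewrite !mulr_sumr -!sumrB; apply: eq_bigr => y _; ring.
by ring.
Qed.

Lemma sum_nbr_const (x : V) (c : R) :
  \sum_(y <- nbr G x) c = (deg G x)%:R * c.
Proof. by rewrite big_const_seq count_predT iter_addr_0 mulr_natl. Qed.

(** Complete the square: with b_z = f z - f y and a = f y - f x, the left-hand
    side is half the mean over z of b_z^2 - 2 a b_z = (b_z - a)^2 - a^2, and
    b_z - a is the second difference of f along x, y, z. *)
Lemma Gamma_sub_Delta f (x y : V) : G x y ->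
  Gamma G f f y - (f y - f x) * Delta G f y =
  2^-1 * ((deg G y)%:R^-1 * \sum_(z <- nbr G y) (f x - 2 * f y + f z) ^+ 2)
  - 2^-1 * (f y - f x) ^+ 2.
Proof.
rewrite adj_sym => /deg_gt0 dy.
have dy0 : (deg G y)%:R != 0 :> R by rewrite pnatr_eq0 -lt0n.
have -> : \sum_(z <- nbr G y) (f x - 2 * f y + f z) ^+ 2 =
    \sum_(z <- nbr G y) (f z - f y) * (f z - f y)
    - 2 * (f y - f x) * \sum_(z <- nbr G y) (f z - f y)
    + (deg G y)%:R * (f y - f x) ^+ 2.
  rewrite -sum_nbr_const mulr_sumr -sumrB -big_split /=.
  by apply: eq_bigr => z _; ring.
by rewrite GammaE /Delta; field.
Qed.

(** The Bochner-type identity: average [Gamma_sub_Delta] over the neighbours y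
    of x. The terms -1/2 (f y - f x)^2 add up to -Gamma f f x, and another
    -Gamma f f x comes from the Laplacian of Gamma, which makes a total of
    -2 Gamma f f x in 2 Gamma2 f f x. *)
Lemma Gamma2E f (x : V) :
  Gamma2 G f f x =
  1 / 2 * Delta G f x ^+ 2 - Gamma G f f x
  + 4^-1 * ((deg G x)%:R^-1 * \sum_(y <- nbr G x)
      (deg G y)%:R^-1 * \sum_(z <- nbr G y) (f x - 2 * f y + f z) ^+ 2).
Proof.
(* A vertex of degree 0 is allowed: the mean of a constant is then 0 instead of
   that constant, but all the terms vanish. *)
have [x0|dx] := posnP (deg G x).
  have n0 : nbr G x = fset0 by apply: cardfs0_eq.
  by rewrite /Gamma2 !GammaE /Delta n0 !big_seq_fset0; ring.
have dx0 : (deg G x)%:R != 0 :> R by rewrite pnatr_eq0 -lt0n.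
set S := \sum_(y <- nbr G x) (deg G y)%:R^-1 * _.
have step : \sum_(y <- nbr G x) (Gamma G f f y - (f y - f x) * Delta G f y)
   = 2^-1 * S - (deg G x)%:R * Gamma G f f x.
  rewrite GammaE mulrCA mulVKf// !mulr_sumr -sumrB !big_seq.
  by apply: eq_bigr => y; rewrite in_nbr => /(Gamma_sub_Delta f) ->.
have -> : Gamma2 G f f x = 2^-1 * ((deg G x)%:R^-1 *
   \sum_(y <- nbr G x) (Gamma G f f y - (f y - f x) * Delta G f y)
   - Gamma G f f x + Delta G f x ^+ 2).
  have cross : \sum_(y <- nbr G x) (f y - f x) * (Delta G f y - Delta G f x)
      = \sum_(y <- nbr G x) (f y - f x) * Delta G f y
        - (deg G x)%:R * Delta G f x ^+ 2.
    have -> : (deg G x)%:R * Delta G f x ^+ 2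
        = (\sum_(y <- nbr G x) (f y - f x)) * Delta G f x.
      by rewrite expr2 mulrA {1}/Delta mulVKf.
    rewrite mulr_suml -sumrB.
    by apply: eq_bigr => y _; ring.
  have symm : Gamma G (Delta G f) f x = Gamma G f (Delta G f) x.
    by rewrite !GammaE; under eq_bigr do rewrite mulrC.
  rewrite /Gamma2 symm (GammaE f (Delta G f)) cross.
  rewrite [Delta G (Gamma G f f) x]/Delta !sumrB sum_nbr_const.
  by field.
by rewrite step; field.
Qed.

(** Keep only the paths x, y, z with z = x or z adjacent to x; as x is not
    adjacent to itself, these two cases do not overlap. *)
Lemma sum_second_difference_ge f (x y : V) : G x y ->
  4 * (f y - f x) ^+ 2
  + \sum_(z <- nbr G x | G y z) (f x - 2 * f y + f z) ^+ 2
  <= \sum_(z <- nbr G y) (f x - 2 * f y + f z) ^+ 2.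
Proof.
move=> xy; rewrite [leRHS](bigID (G x)) /= [leRHS]addrC; apply: lerD.
  rewrite (big_rem x) /= ?in_nbr 1?adj_sym // adj_irr /=.
  have -> : (f x - 2 * f y + f x) ^+ 2 = 4 * (f y - f x) ^+ 2 by ring.
  by rewrite lerDl sumr_ge0 // => z _; rewrite sqr_ge0.
rewrite -big_filter -[leRHS]big_filter.
rewrite (perm_big [seq z <- nbr G y | G x z]) //=.
apply: uniq_perm; rewrite ?filter_uniq ?fset_uniq // => z.
by rewrite !mem_filter !in_nbr andbC.
Qed.

Lemma sum_adj_swap (r : seq V) (h : V -> V -> R) :
  \sum_(y <- r) \sum_(z <- r | G y z) h y z =
  \sum_(y <- r) \sum_(z <- r | G y z) h z y.
Proof.
rewrite (exchange_big_dep predT) //=; apply: eq_bigr => y _.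
by apply: eq_bigl => z; rewrite adj_sym.
Qed.

(** Both orientations of a triangle x, y, z are needed: with a_y = f y - f x, the
    square (a_z - 2 a_y)^2 may be 0, but together with (a_y - 2 a_z)^2 it is at
    least a_y^2 + a_z^2. Summing over ordered pairs counts each a_y^2 once per
    triangle on the edge x y, hence at least once. *)
Lemma sum_sqr_le_triangles f (x : V) :
  (forall y, G x y -> exists2 z, G x z & G y z) ->
  \sum_(y <- nbr G x) (f y - f x) ^+ 2 <=
  \sum_(y <- nbr G x) \sum_(z <- nbr G x | G y z) (f x - 2 * f y + f z) ^+ 2.
Proof.
move=> triangle.
apply: (@le_trans _ _
  (\sum_(y <- nbr G x) \sum_(z <- nbr G x | G y z) (f y - f x) ^+ 2)).
  rewrite !big_seq; apply: ler_sum => y; rewrite in_nbr => /triangle[z xz yz].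
  rewrite (big_rem z) /= ?in_nbr // yz lerDl.
  by apply: sumr_ge0 => u _; rewrite sqr_ge0.
(* Double both sides, and swap the roles of y and z in one of the two copies. *)
rewrite -(ler_pM2l (ltr0n R 2)) !mulr_natl !mulr2n.
rewrite {2}sum_adj_swap {2}[in leRHS]sum_adj_swap.
rewrite -!big_split /=; apply: ler_sum => y _.
rewrite -!big_split /=; apply: ler_sum => z _.
have := sqr_ge0 (f y - f z); nra.
Qed.

(** The constant 5 is 4 + 1: 4 from the paths that return to x, and 1 from the
    triangles. *)
Lemma sum_second_difference_lower_bound f (x : V) :
  (forall y, G x y -> exists2 z, G x z & G y z) ->
  5 / (maxdeg_nbr G x)%:R * \sum_(y <- nbr G x) (f y - f x) ^+ 2 <=
  \sum_(y <- nbr G x)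
    (deg G y)%:R^-1 * \sum_(z <- nbr G y) (f x - 2 * f y + f z) ^+ 2.
Proof.
move=> triangle.
apply: (@le_trans _ _ ((maxdeg_nbr G x)%:R^-1 * \sum_(y <- nbr G x)
    (4 * (f y - f x) ^+ 2
     + \sum_(z <- nbr G x | G y z) (f x - 2 * f y + f z) ^+ 2))).
  rewrite [5 / _]mulrC -mulrA ler_wpM2l ?invr_ge0 ?ler0n //.
  rewrite big_split -mulr_sumr /=.
  have := sum_sqr_le_triangles f triangle; lra.
rewrite mulr_sumr !big_seq; apply: ler_sum => y; rewrite in_nbr => xy.
have dy : (0 < deg G y)%N by apply: (@deg_gt0 _ G y x); rewrite adj_sym.
apply: ler_pM; rewrite ?invr_ge0 ?ler0n //.
- apply: addr_ge0; first by rewrite mulr_ge0 ?sqr_ge0.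
  by apply: sumr_ge0 => z _; rewrite sqr_ge0.
- by rewrite lef_pV2 ?posrE ?ltr0n ?(leq_trans dy) ?ler_nat ?deg_le_maxdeg_nbr.
- exact: sum_second_difference_ge.
Qed.

End BakryEmery.

Theorem corollary2 (R : realType) (V : choiceType) (G : lfgraph V)
  (hkappa : forall x y : V, G x y -> (0 < kappa R G x y)%E) :
  forall (f : V -> R) (x : V),
    Gamma2 G f f x >=
      1 / 2 * (Delta G f x) ^+ 2
      + (5 / (2 * (maxdeg_nbr G x)%:R) - 1) * Gamma G f f x.
Proof.
move=> f x.
have bound := sum_second_difference_lower_bound f
  (fun y xy => kappa_gt0_triangle xy (hkappa x y xy)).
have dx : 0 <= (deg G x)%:R^-1 :> R by rewrite invr_ge0 ler0n.
have := ler_wpM2l dx bound.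
have Gamma_sqr : Gamma G f f x =
    2^-1 * ((deg G x)%:R^-1 * \sum_(y <- nbr G x) (f y - f x) ^+ 2).
  by rewrite GammaE; under eq_bigr do rewrite -expr2.
rewrite Gamma2E Gamma_sqr invfM.
lra.
Qed.
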